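(* Let $K=\mathbb{Q}(\sqrt5)$. Lee's set $$\mathcal{C}=\Bigl\{1,\ 2,\ \tfrac{5+\sqrt5}{2},\ \tfrac{7+\sqrt5}{2},\ \tfrac{7-\sqrt5}{2},\ 2\cdot\tfrac{5+\sqrt5}{2},\ 3\cdot\tfrac{5+\sqrt5}{2}\Bigr\}$$ is minimal, i.e. it equals $\mathcal{C}^{\mathrm{cl}}_{K}$: for every $\alpha\in\mathcal{C}$ there exists a classical quadratic lattice $L_\alpha$ over $K$ which represents all other elements of $\mathbb{Z}\bigl[\frac{1+\sqrt5}{2}\bigr]^+$ but not (any element of) $\alpha\,\mathcal{U}_K^2$.
   Context: $K=\mathbb{Q}(\sqrt5)$, $\mathcal{O}_K=\mathbb{Z}[\frac{1+\sqrt5}2]$, $\mathcal{O}_K^+=\mathbb{Z}[\frac{1+\sqrt5}2]^+$ is the set of totally positive elements, $\mathcal{U}_K^2$ the group of squares of units. A classical quadratic lattice is a finitely generated torsion-free $\mathcal{O}_K$-module $L$ with a quadratic map $Q:L\to\mathcal{O}_K$ whose bilinear form $B_Q(v,w)=\frac12(Q(v+w)-Q(v)-Q(w))$ takes values in $\mathcal{O}_K$; it is always assumed totally positive definite, i.e. $Q(v)\in\mathcal{O}_K^+$ for $v\neq0$. $L$ represents $\alpha$ if $Q(v)=\alpha$ for some $v\in L$; this depends only on the class $\alpha\,\mathcal{U}_K^2$, and elements of $\mathcal{O}_K^+$ are identified with their classes in $\mathcal{O}_K^+/\mathcal{U}_K^2$. $L$ is universal if it represents all of $\mathcal{O}_K^+$.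 A (classical) criterion set is a subset $\mathcal{C}'$ of $\mathcal{O}_K^+/\mathcal{U}_K^2$ such that a classical lattice is universal if and only if it represents all elements of $\mathcal{C}'$. $\mathcal{C}^{\mathrm{cl}}_K$ denotes the set of all $\alpha$ for which some classical lattice represents every class except $\alpha$; it is the unique minimal classical criterion set. Lee (known theorem) proved that $\mathcal{C}$ is a classical criterion set. *)

(* Defs.v *)
From HB Require Import structures.
From mathcomp Require Import all_boot all_order all_algebra all_field.
From mathcomp Require Import ring.

Set Implicit Arguments.
Unset Strict Implicit.
Unset Printing Implicit Defensive.

Import Order.TTheory GRing.Theory Num.Theory.
Local Open Scope ring_scope.

Definition golden : algC := (1 + sqrtC 5) / 2.

Definition inOK : {pred algC} := Cint_span [:: 1; golden].

Lemma inOKP (x : algC) :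
  reflect (exists a b : int, x = a%:~R + b%:~R * golden) (x \in inOK).
Proof.
apply: (iffP (Cint_spanP [tuple 1; golden] x)) => [[a ->]|[a [b ->]]].
  exists (a ord0), (a (lift ord0 ord0)).
  by rewrite big_ord_recl big_ord1 /= mulrzl.
exists [ffun i : 'I_2 => if i == ord0 then a else b].
by rewrite big_ord_recl big_ord1 !ffunE /= mulrzl.
Qed.

Lemma golden_sqr : golden * golden = golden + 1.
Proof.
have s5 : sqrtC 5 * sqrtC 5 = 5 :> algC by rewrite -expr2 sqrtCK.
have -> : golden * golden = (1 + 2 * sqrtC 5 + sqrtC 5 * sqrtC 5) / 4.
  by rewrite /golden; field.
by rewrite s5 /golden; field.
Qed.

Lemma inOK_subring_closed : subring_closed inOK.
Proof.
split=> [|x y|x y].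
- by apply/inOKP; exists 1, 0; rewrite mul0r addr0.
- exact: rpredB.
move=> /inOKP[a [b ->]] /inOKP[c [d ->]]; apply/inOKP.
exists (a * c + b * d), (a * d + b * c + b * d).
rewrite !rmorphD !rmorphM /= !mulrDl !mulrDr.
have E := golden_sqr.
by rewrite [b%:~R * golden * (d%:~R * golden)]mulrACA E; ring.
Qed.

HB.instance Definition _ :=
  GRing.isSubringClosed.Build algC inOK inOK_subring_closed.

(* The ring of integers of Q(sqrt 5), as a subring of algC. *)
Record OK := MkOK { OKval :> algC; OKvalP : OKval \in inOK }.

HB.instance Definition _ := [isSub for OKval].
HB.instance Definition _ := [Choice of OK by <:].
HB.instance Definition _ := [SubChoice_isSubComNzRing of OK by <:].
HB.instance Definition _ := GRing.RMorphism.copy OKval (val : OK -> algC).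

(* The ring morphisms OK -> algC are the restrictions of the two embeddings of
   Q(sqrt 5) into C (both are real), and 0 < z in algC means that z is a
   positive real number. *)
Definition totally_positive (a : OK) : Prop :=
  forall sigma : {rmorphism OK -> algC}, 0 < sigma a.

Definition is_unit (u : OK) : Prop := exists w : OK, u * w = 1.

(* Equality of the classes of a and b modulo squares of units. *)
Definition same_class (a b : OK) : Prop :=
  exists2 u : OK, is_unit u & b = u ^+ 2 * a.

Section Lattices.

Variable L : lmodType OK.

Definition finitely_generated : Prop :=
  exists s : seq L, forall v : L,
    exists c : 'I_(size s) -> OK, v = \sum_(i < size s) c i *: s`_i.

Definition torsion_free : Prop :=
  forall (a : OK) (v : L), a *: v = 0 -> a = 0 \/ v = 0.

(* B_Q takes values in the field Q(sqrt 5), hence is taken in algC. *)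
Definition polar (Q : L -> OK) (v w : L) : algC :=
  (OKval (Q (v + w)) - OKval (Q v) - OKval (Q w)) / 2.

Definition quadratic_map (Q : L -> OK) : Prop :=
  [/\ forall (a : OK) (v : L), Q (a *: v) = a ^+ 2 * Q v,
      forall (a : OK) (u v w : L),
        polar Q (a *: u + v) w = OKval a * polar Q u w + polar Q v w
    & forall (a : OK) (u v w : L),
        polar Q w (a *: u + v) = OKval a * polar Q w u + polar Q w v].

(* Total positive definiteness is part of the definition. *)
Definition classical_lattice (Q : L -> OK) : Prop :=
  [/\ finitely_generated,
      torsion_free,
      quadratic_map Q,
      forall v w : L, polar Q v w \in inOK
    & forall v : L, v != 0 -> totally_positive (Q v)].

Definition represents (Q : L -> OK) (a : OK) : Prop := exists v : L, Q v = a.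

Definition universal (Q : L -> OK) : Prop :=
  forall a : OK, totally_positive a -> represents Q a.

End Lattices.

(* Subsets of OK^+ / U^2 are encoded as predicates on OK^+ that are saturated
   for same_class. *)
Definition class_set (S : OK -> Prop) : Prop :=
  (forall a : OK, S a -> totally_positive a) /\
  (forall a b : OK, same_class a b -> S a -> S b).

Definition criterion_set (S : OK -> Prop) : Prop :=
  class_set S /\
  forall (L : lmodType OK) (Q : L -> OK), classical_lattice Q ->
    (universal Q <-> forall a : OK, S a -> represents Q a).

Definition minimal_criterion_set (S : OK -> Prop) : Prop :=
  criterion_set S /\
  forall S' : OK -> Prop, criterion_set S' ->
    (forall a : OK, S' a -> S a) -> forall a : OK, S a -> S' a.

Definition represents_all_but (L : lmodType OK) (Q : L -> OK) (a : OK) : Prop :=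
  forall b : OK, totally_positive b -> (represents Q b <-> ~ same_class a b).

(* The set C^cl_K. *)
Definition Ccl (a : OK) : Prop :=
  totally_positive a /\
  exists (L : lmodType OK) (Q : L -> OK),
    classical_lattice Q /\ represents_all_but Q a.

Definition lee_list : seq algC :=
  [:: 1; 2; (5 + sqrtC 5) / 2; (7 + sqrtC 5) / 2; (7 - sqrtC 5) / 2;
      2 * ((5 + sqrtC 5) / 2); 3 * ((5 + sqrtC 5) / 2)].

Lemma lee_list_inOK : {subset lee_list <= inOK}.
Proof.
have E (s : algC) : (5 + s) / 2 = 2 + (1 + s) / 2 by field.
have F (s : algC) : (7 + s) / 2 = 3 + (1 + s) / 2 by field.
have G (s : algC) : (7 - s) / 2 = 4 - (1 + s) / 2 by field.
have gP : (1 + sqrtC 5) / 2 \in inOK.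
  by apply/inOKP; exists 0, 1; rewrite mul1r add0r.
have nP n : n%:R \in inOK by apply: rpred_nat.
have dP : 2 + (1 + sqrtC 5) / 2 \in inOK by exact: rpredD (nP 2) gP.
apply/allP; rewrite /= E F G !andbT rpred1 (nP 2) dP /=.
apply/and4P; split; [exact: rpredD (nP 3) gP | exact: rpredB (nP 4) gP
                   | exact: rpredM (nP 2) dP | exact: rpredM (nP 3) dP].
Qed.

(* The classes of the elements of lee_list. *)
Definition lee_set (a : OK) : Prop :=
  exists2 c : OK, OKval c \in lee_list & same_class c a.

(* Main.v *)
Require Import Defs.
From HB Require Import structures.
From mathcomp Require Import all_boot all_order all_algebra all_field.
From mathcomp Require Import ring zify.
From Stdlib Require Import Classical.

Set Implicit Arguments.
Unset Strict Implicit.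
Unset Printing Implicit Defensive.

Import Order.TTheory GRing.Theory Num.Theory.
Local Open Scope ring_scope.

(** Write phi for the golden ratio and beta = phi^2 = phi + 1; the squares of
units are the powers of beta.  Say that x lies below y when y - x is zero or
totally positive.

Every totally positive element is, up to a power of beta, of the form
a + b beta with natural numbers a and b [cone_class]: multiplying by a power
of beta until the trace is minimal brings it into this cone, up to one more
factor beta.  By the four-square theorem [sum_of_four_squares] a and b are sums
of four squares, and beta is a square, so the sum I_8 of eight squares
represents all of the cone [cone_sum_squares].

For each alpha the lattice is M + d I_8 (an orthogonal sum), with d a small
natural number and M a fixed lattice.

- It represents all other classes.  If M represents f then M + d I_8 represents
  f + d (k + l beta) for all natural k and l, so it suffices that every pair
  (a, b) outside the class of alpha dominates, modulo d, a value of M.  Only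
  finitely many pairs must be inspected [coverP].

- It does not represent alpha.  All values are zero or totally positive, so in
  an orthogonal sum whose value is alpha each summand takes a value below
  alpha.  Only finitely many vectors have such values, because the trace form
  is positive definite [square_in_box]; the values below alpha are therefore a
  computable list, which is computed one orthogonal summand at a time
  [diag_below], and alpha is not in the list.

[missing_class] combines the two points.  What remains is the choice of M: it
must represent everything strictly below alpha, but not alpha.
- 1 is minimal, so the part of M below 1 is 0;
- 2 = 1 + 1 and 2 + phi = 1 + phi^2 are not represented by x^2;
- 3 + phi and its conjugate 4 - phi are not represented by x^2 + y^2;
- 2 (2 + phi) is not represented by x^2 + 2 y^2 + (2 + phi) z^2;
- this form misses 3 (2 + phi) as well, but the missing value 2 (2 + phi) cannot
  be added as an orthogonal summand, since (2 + phi) + 2 (2 + phi) = 3 (2 + phi);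
  it is added by a vector that has inner product phi with the vector of value
  2 + phi, which gives [binary_form].
The number d is so large that no nonzero value of d I_8 lies below alpha.  Nor
does any nonzero value of the other summands of M, which only supply the
residues modulo d that are still missing.

Minimality is then formal: a criterion set that is disjoint from the class of
alpha would declare the lattice of alpha universal [criterion_meets_missed]. *)

Lemma golden_inOK : golden \in inOK.
Proof. by apply/inOKP; exists 0, 1; rewrite mul1r add0r. Qed.

Definition phi : OK := MkOK golden_inOK.

Lemma phi_sqr : phi * phi = phi + 1.
Proof. by apply: val_inj; rewrite /= golden_sqr. Qed.

(** * Coordinates and total positivity *)

(** The pair (p, q) stands for p + q phi, so that questions about elements can
be decided by computing with integers. *)
Definition elt (x : int * int) : OK := x.1%:~R + x.2%:~R * phi.

Definition pmul (x y : int * int) : int * int :=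
  (x.1 * y.1 + x.2 * y.2, x.1 * y.2 + x.2 * y.1 + x.2 * y.2).

Definition trace (x : int * int) : int := 2 * x.1 + x.2.
Definition norm (x : int * int) : int := x.1 ^+ 2 + x.1 * x.2 - x.2 ^+ 2.

Lemma eltD x y : elt (x + y) = elt x + elt y.
Proof. by rewrite /elt /= !rmorphD /=; ring. Qed.

Lemma eltN x : elt (- x) = - elt x.
Proof. by rewrite /elt /= !rmorphN /=; ring. Qed.

Lemma eltM x y : elt (pmul x y) = elt x * elt y.
Proof.
have -> : elt x * elt y = x.1%:~R * y.1%:~R
    + (x.1%:~R * y.2%:~R + x.2%:~R * y.1%:~R) * phi
    + x.2%:~R * y.2%:~R * (phi * phi) by rewrite /elt; ring.
by rewrite phi_sqr /elt /pmul /= !(intrD, intrM); ring.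
Qed.

Lemma elt_surj (a : OK) : exists x, a = elt x.
Proof.
have /inOKP[p [q E]] := OKvalP a.
exists (p, q); apply: val_inj; rewrite [LHS]E /elt.
by rewrite (rmorphD OKval) (rmorphM OKval) !(rmorph_int OKval).
Qed.

(** 4 N(p, q) = (2 p + q)^2 - 5 q^2, and 5 is not the square of a rational:
the 5-adic valuations of the two squares have the same parity. *)
Lemma norm_eq0 x : (norm x == 0) = (x == 0).
Proof.
case: x => p q; apply/eqP/eqP => [|[-> ->] //]; rewrite /norm /= => N0.
have E : (`|(2 * p + q)%R| ^ 2 = 5 * `|q| ^ 2)%N.
  by rewrite -!abszX -[5%N]/(`|5|%N) -abszM; congr absz; lia.
have [q0|q_gt0] := posnP `|q|%N.
  have p0 : p = 0 by move: E; rewrite q0; nia.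
  by congr pair => //; lia.
have p_gt0 : (0 < `|(2 * p + q)%R|)%N by rewrite lt0n; apply/eqP => F; move: E; rewrite F; nia.
have /(congr1 (logn 5)) := E.
by rewrite lognM // ?expn_gt0 ?q_gt0 // !lognX (_ : logn 5 5 = 1)%N //; lia.
Qed.

(** If p + q phi = 0 then its norm, the product of p + q phi with its conjugate
(p + q) - q phi, is zero too. *)
Lemma elt_inj : injective elt.
Proof.
move=> x y E; apply/eqP; rewrite -subr_eq0 -norm_eq0.
have {E} : elt (x - y) = 0 by rewrite eltD eltN E subrr.
move: (x - y) => {x y} [p q] E.
have F : elt (pmul (p, q) (p + q, - q)) = 0 by rewrite eltM E mul0r.
have : elt (norm (p, q), 0) = 0.
  by rewrite -F; congr elt; rewrite /pmul /norm /=; congr pair; ring.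
rewrite /elt /= mul0r addr0 => /(congr1 OKval); rewrite rmorph_int rmorph0.
by move/eqP; rewrite intr_eq0.
Qed.

(** A preimage under [elt], to define a map on OK by coordinates. *)
Definition coords (a : OK) : int * int :=
  xchoose (let: ex_intro x e := elt_surj a in ex_intro _ x (introT eqP e)).

Lemma coordsK : cancel coords elt.
Proof. by move=> a; apply/esym/eqP; apply: (xchooseP (P := fun x => a == elt x)). Qed.

(** The embedding that sends phi to 1 - golden: total positivity quantifies over
embeddings, so this one has to exist for it to give the sign of the conjugate. *)
Definition conj (a : OK) : algC :=
  (coords a).1%:~R + (coords a).2%:~R * (1 - golden).

Lemma conj_elt x : conj (elt x) = x.1%:~R + x.2%:~R * (1 - golden).
Proof. by rewrite /conj (elt_inj (coordsK (elt x))). Qed.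

Lemma conj_is_zmod_morphism : zmod_morphism conj.
Proof.
move=> a b; rewrite -[a]coordsK -[b]coordsK -eltN -eltD !conj_elt /=.
by rewrite !rmorphB /=; ring.
Qed.

Lemma conj_is_monoid_morphism : monoid_morphism conj.
Proof.
split=> [|a b].
  have -> : 1 = elt (1, 0) by rewrite /elt mul0r addr0.
  by rewrite conj_elt /= mul0r addr0.
rewrite -[a]coordsK -[b]coordsK -eltM !conj_elt /= !(rmorphD, rmorphM) /=.
have E : (1 - golden) * (1 - golden) = (1 - golden) + 1.
  by have := golden_sqr; set g := golden => G; rewrite mulrBl !mulrBr G; ring.
set g := 1 - golden in E *; set x := coords a; set y := coords b.
have -> : (x.1%:~R + x.2%:~R * g) * (y.1%:~R + y.2%:~R * g)
    = x.1%:~R * y.1%:~R + (x.1%:~R * y.2%:~R + x.2%:~R * y.1%:~R) * g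
      + x.2%:~R * y.2%:~R * (g * g) by ring.
by rewrite E; ring.
Qed.

HB.instance Definition _ :=
  GRing.isZmodMorphism.Build OK algC conj conj_is_zmod_morphism.
HB.instance Definition _ :=
  GRing.isMonoidMorphism.Build OK algC conj conj_is_monoid_morphism.

(** The two conjugates are real, and two reals are positive exactly when their
sum and product are. *)
Definition tp (x : int * int) : bool := (0 < trace x) && (0 < norm x).

Lemma golden_real : golden \is Num.real.
Proof.
rewrite /golden; apply: rpredM; last by rewrite realV.
by apply: rpredD; [exact: rpred1 | apply: ger0_real; rewrite sqrtC_ge0 ler0n].
Qed.

Lemma elt_sigma (sigma : {rmorphism OK -> algC}) x :
  sigma (elt x) = x.1%:~R + x.2%:~R * sigma phi.
Proof. by rewrite rmorphD rmorphM !rmorph_int. Qed.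

Lemma trace_norm (g : algC) x : g * g = g + 1 ->
  let u := x.1%:~R + x.2%:~R * g in let v := x.1%:~R + x.2%:~R * (1 - g) in
  u + v = (trace x)%:~R /\ u * v = (norm x)%:~R.
Proof.
move=> G u v; split; rewrite /u /v /trace /norm.
  by rewrite intrD intrM; ring.
have -> : (x.1%:~R + x.2%:~R * g) * (x.1%:~R + x.2%:~R * (1 - g))
   = x.1%:~R ^+ 2 + x.1%:~R * x.2%:~R - x.2%:~R ^+ 2 * (g * g - g) by ring.
by rewrite G intrB intrD intrM !rmorphXn /=; ring.
Qed.

Lemma totally_positive_elt x : totally_positive (elt x) <-> tp x.
Proof.
split=> [pos|/andP[tr nm] sigma].
  have := pos (OKval : {rmorphism OK -> algC}); rewrite elt_sigma.
  have := pos (conj : {rmorphism OK -> algC}).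
  rewrite [X in 0 < X](conj_elt x) => v0 u0.
  have [] := trace_norm x golden_sqr.
  set u := (_ + _ * golden); set v := (_ + _ * (1 - golden)).
  move=> E F; apply/andP; split.
    by rewrite -(ltr0z algC) -E addr_gt0.
  by rewrite -(ltr0z algC) -F mulr_gt0.
rewrite elt_sigma.
have G : sigma phi * sigma phi = sigma phi + 1.
  by rewrite -rmorphM phi_sqr rmorphD rmorph1.
(* sigma phi is a root of X^2 - X - 1, hence one of the two real roots *)
have gR : sigma phi \is Num.real.
  have : (sigma phi - golden) * (sigma phi - (1 - golden)) = 0.
    have -> : (sigma phi - golden) * (sigma phi - (1 - golden))
      = sigma phi * sigma phi - sigma phi - (golden * golden - golden) by ring.
    by rewrite G golden_sqr; ring.
  move/eqP; rewrite mulf_eq0 !subr_eq0.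
  by case/orP=> /eqP->; rewrite ?rpredB ?golden_real ?rpred1.
have [] := trace_norm x G.
set u := (_ + _ * sigma phi); set v := (_ + _ * (1 - _)) => E F.
have uR : u \is Num.real.
  by apply: rpredD; [exact: realz | apply: rpredM; [exact: realz|]].
have vR : v \is Num.real.
  apply: rpredD; first exact: realz.
  by apply: rpredM; [exact: realz | apply: rpredB => //; exact: rpred1].
have s0 : 0 < u + v by rewrite E ltr0z.
have m0 : 0 < u * v by rewrite F ltr0z.
have u_neq0 : u != 0 by apply: contraTneq m0 => ->; rewrite mul0r ltxx.
have [u0|u0] := orP uR; first by rewrite lt_def u_neq0.
have {u_neq0}u0 : u < 0 by rewrite lt_def eq_sym u_neq0.
have v0 : v < 0 by rewrite -(nmulr_rgt0 _ u0).
have : 0 < - (u + v) by rewrite opprD addr_gt0 // oppr_gt0.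
by rewrite oppr_gt0 => /(lt_trans s0); rewrite ltxx.
Qed.

(** * Square classes and the fundamental cone *)

Lemma same_class_refl a : same_class a a.
Proof. by exists 1; [exists 1; rewrite mulr1 | rewrite expr1n mul1r]. Qed.

Lemma same_class_sym a b : same_class a b -> same_class b a.
Proof.
move=> [u [w uw] ->]; exists w; first by exists u; rewrite mulrC.
by rewrite mulrA -exprMn [w * u]mulrC uw expr1n mul1r.
Qed.

Lemma same_class_trans a b c : same_class a b -> same_class b c -> same_class a c.
Proof.
move=> [u [u' uu] ->] [v [v' vv] ->]; exists (v * u); last by rewrite exprMn mulrA.
by exists (v' * u'); rewrite mulrACA uu vv mulr1.
Qed.

Lemma phi_unit : is_unit phi.
Proof. by exists (phi - 1); rewrite mulrBr phi_sqr mulr1; ring. Qed.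

Lemma totally_positiveD a b :
  totally_positive a -> totally_positive b -> totally_positive (a + b).
Proof. by move=> Pa Pb s; rewrite rmorphD addr_gt0. Qed.

Lemma totally_positiveM a b :
  totally_positive a -> totally_positive b -> totally_positive (a * b).
Proof. by move=> Pa Pb s; rewrite rmorphM mulr_gt0. Qed.

Lemma tpM x y : tp x -> tp y -> tp (pmul x y).
Proof.
move=> /totally_positive_elt px /totally_positive_elt py.
by apply/totally_positive_elt; rewrite eltM; exact: totally_positiveM.
Qed.

Definition beta : int * int := (1, 1).

(** Conversion from coordinates over 1 and beta to coordinates over 1 and phi. *)
Definition cone (a b : nat) : int * int := (a%:Z + b%:Z, b%:Z).

Lemma elt_beta : elt beta = phi ^+ 2.
Proof. by rewrite expr2 phi_sqr /elt /=; ring. Qed.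

Lemma same_class_beta x : same_class (elt x) (elt (pmul beta x)).
Proof. by exists phi; [exact: phi_unit | rewrite eltM elt_beta]. Qed.

Lemma tpP x : tp x -> 0 < trace x /\ 0 < norm x. Proof. by move/andP. Qed.

(* (2, -1) is the inverse of beta *)
Lemma pmul_betaVK x : pmul beta (pmul (2, -1) x) = x.
Proof. by case: x => p q; rewrite /pmul /=; congr pair; ring. Qed.

(** Descent on the trace: multiplication by beta changes the trace 2 p + q into
3 p + 4 q, and multiplication by its inverse into 3 p - q.  If neither decreases it
then -p <= 3 q and 2 q <= p, and either p + q phi or its product with beta has
nonnegative coordinates over 1 and beta. *)
Lemma cone_class x : tp x -> exists a b : nat, same_class (elt (cone a b)) (elt x).
Proof.
have in_cone p q : 0 <= q -> q <= p ->
    exists a b : nat, same_class (elt (cone a b)) (elt (p, q)).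
  move=> q0 qp; exists `|p - q|%N, `|q|%N.
  suff -> : cone `|p - q| `|q| = (p, q) by exact: same_class_refl.
  by rewrite /cone; congr pair; lia.
have [n] := ubnP `|trace x|%N; elim: n x => // n IHn [p q] lt_n tpx.
have [tr nm] := tpP tpx; rewrite /trace /norm /= in tr nm lt_n *.
have [q0|q0] := lerP 0 q; last first.
  have [lt|ge] := ltrP p (- 3 * q).
    have tp' : tp (pmul beta (p, q)) by apply: tpM.
    have [||a [b C]] := IHn (pmul beta (p, q)) => //.
      by have [] := tpP tp'; rewrite /trace /=; lia.
    exists a, b; apply: same_class_trans C _.
    exact/same_class_sym/same_class_beta.
  have [||a [b C]] := in_cone (p + q) (p + 2 * q); [lia|lia|].
  exists a, b; apply: same_class_trans C _; apply: same_class_sym.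
  have -> : (p + q, p + 2 * q) = pmul beta (p, q).
    by rewrite /pmul /=; congr pair; ring.
  exact: same_class_beta.
have [qp|pq] := lerP q p; first exact: in_cone.
have tp' : tp (pmul (2, -1) (p, q)) by apply: tpM.
have [||a [b C]] := IHn (pmul (2, -1) (p, q)) => //.
  by have [] := tpP tp'; rewrite /trace /=; lia.
exists a, b; apply: same_class_trans C _.
by rewrite -{2}[(p, q)]pmul_betaVK; exact: same_class_beta.
Qed.

Lemma totally_positive_sqr a : a != 0 -> totally_positive (a ^+ 2).
Proof.
have [x ->] := elt_surj a => a_neq0; rewrite expr2 -eltM; apply/totally_positive_elt.
have {a_neq0} : norm x != 0.
  by rewrite norm_eq0; apply: contraNneq a_neq0 => ->; rewrite /elt mul0r addr0.
case: x => p q; rewrite /tp /trace /norm /= => nm.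
have -> : (p * p + q * q) ^+ 2 + (p * p + q * q) * (p * q + q * p + q * q)
   - (p * q + q * p + q * q) ^+ 2 = (p ^+ 2 + p * q - q ^+ 2) ^+ 2 by ring.
by rewrite exprn_even_gt0 //= nm andbT; nia.
Qed.

Lemma totally_positive_neq0 a : totally_positive a -> a != 0.
Proof. by move=> /(_ conj); apply: contraTneq => ->; rewrite rmorph0 ltxx. Qed.

(** Totally nonnegative: as the norm vanishes only at 0, an element with
nonnegative conjugates is zero or totally positive. *)
Definition tnn (x : int * int) : bool := (x == 0) || tp x.

Lemma tnnP x : reflect (elt x = 0 \/ totally_positive (elt x)) (tnn x).
Proof.
have E0 : elt 0 = 0 by rewrite /elt mul0r addr0.
apply: (iffP orP) => -[].
- by move/eqP=> ->; left.
- by right; apply/totally_positive_elt.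
- by rewrite -E0 => /elt_inj->; left.
- by move/totally_positive_elt; right.
Qed.

Lemma tnnD x y : tnn x -> tnn y -> tnn (x + y).
Proof.
move=> /tnnP[x0|px] /tnnP[y0|py]; apply/tnnP; rewrite eltD.
- by left; rewrite x0 y0 addr0.
- by right; rewrite x0 add0r.
- by right; rewrite y0 addr0.
- by right; apply: totally_positiveD.
Qed.

Lemma tnnM x y : tnn x -> tnn y -> tnn (pmul x y).
Proof.
move=> /tnnP[x0|px] /tnnP[y0|py]; apply/tnnP; rewrite eltM;
  do ?[by left; rewrite ?x0 ?y0 ?mul0r ?mulr0].
by right; apply: totally_positiveM.
Qed.

Lemma tnn_sqr x : tnn (pmul x x).
Proof.
have [e0|ne0] := eqVneq (elt x) 0.
  by apply/tnnP; left; rewrite eltM e0 mul0r.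
by apply/tnnP; right; rewrite eltM -expr2; apply: totally_positive_sqr.
Qed.

(** * Sums of four squares *)

Definition four_squares (n : int) : Prop :=
  exists a b c d : int, n = a ^+ 2 + b ^+ 2 + c ^+ 2 + d ^+ 2.

(** Euler's identity, that is, multiplicativity of the norm of quaternions. *)
Lemma four_squaresM m n :
  four_squares m -> four_squares n -> four_squares (m * n).
Proof.
move=> [a [b [c [d ->]]]] [e [f [g [h ->]]]].
exists (a * e + b * f + c * g + d * h), (a * f - b * e + c * h - d * g),
  (a * g - b * h - c * e + d * f), (a * h + b * g - c * f - d * e).
ring.
Qed.

Lemma centered_residue (m a : int) : 0 < m ->
  exists r k : int, [/\ a = r + m * k, - m <= 2 * r & 2 * r <= m].
Proof.
move=> m0; have E := divz_eq a m.
have r0 := modz_ge0 a (lt0r_neq0 m0); have rm := ltz_pmod a m0.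
have [le|gt] := lerP (2 * (a %% m)%Z) m.
  by exists (a %% m)%Z, (a %/ m)%Z; split; lia.
by exists ((a %% m)%Z - m), ((a %/ m)%Z + 1); split; lia.
Qed.

(** Pigeonhole in F_p: the (p + 1) / 2 elements x^2 and the (p + 1) / 2 elements
-1 - y^2, for x and y at most (p - 1) / 2, cannot all be distinct. *)
Lemma minus_one_sum_two_squares p : prime p -> odd p ->
  exists x y : nat, [/\ (2 * x < p)%N, (2 * y < p)%N & (p %| x ^ 2 + y ^ 2 + 1)%N].
Proof.
move=> p_pr p_odd; set h := p./2; have pE : p = (2 * h + 1)%N by rewrite /h; lia.
have chp := pchar_Fp p_pr.
pose f (x : 'I_h.+1) : 'F_p := (x : nat)%:R ^+ 2.
have f_inj : injective f.
  move=> x y; have [x_le y_le] := (ltn_ord x, ltn_ord y).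
  wlog le_yx : x y x_le y_le / (y <= x)%N.
    move=> W fE; have [le|/ltnW le] := leqP y x; first exact: W fE.
    by apply/esym/W.
  move/eqP; rewrite -subr_eq0 subr_sqr mulf_eq0 -natrD -natrB //.
  rewrite -!(dvdn_pcharf chp) => E; apply: val_inj => /=.
  case/orP: E => [/dvdn_leq|].
    by case: (posnP (x - y)%N) => [|gt0 /(_ isT)]; lia.
  by move=> /dvdn_leq; case: (posnP (x + y)%N) => [|gt0 /(_ isT)]; lia.
pose g x := - 1 - f x.
have g_inj : injective g by move=> x y /addrI/oppr_inj/f_inj.
have [z] : exists z, z \in [set f x | x : 'I_h.+1] :&: [set g x | x : 'I_h.+1].
  apply/set0Pn/negP => /eqP I0.
  have := max_card (mem ([set f x | x : 'I_h.+1] :|: [set g x | x : 'I_h.+1])).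
  rewrite cardsU I0 cards0 !card_imset // card_Fp // card_ord; lia.
rewrite inE => /andP[/imsetP[x _ ->] /imsetP[y _ E]].
have [x_le y_le] := (ltn_ord x, ltn_ord y).
exists x, y; split; [lia|lia|].
rewrite (dvdn_pcharf chp) !natrD !natrX; apply/eqP.
by rewrite -/(f x) -/(f y) E /g; ring.
Qed.

(** Lagrange's descent: reduce a, b, c, d modulo m to centered residues e, f, g,
h, whose squares sum to m r with r <= m, and apply Euler's identity to
(m p) (m r), where every square is divisible by m^2.  With centered residues
the extreme cases r = 0 and r = m both force m to divide p, which spares a
separate treatment of even m. *)
Lemma four_squares_descent (p : nat) (m : int) : prime p -> 1 < m -> m < p%:Z ->
  four_squares (m * p%:Z) ->
  exists2 r : int, 0 < r < m & four_squares (r * p%:Z).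
Proof.
move=> p_pr m1 mp [a [b [c [d E]]]].
have m0 : 0 < m by lia.
have m_ndvd (k : int) : p%:Z = m * k -> False.
  move=> pE; have : (`|m| %| p)%N by apply/dvdnP; exists `|k|%N; lia.
  by move=> /(primeP p_pr).2/orP[] /eqP; lia.
have m_neq0 : m != 0 by lia.
have [e [k1 [aE e1 e2]]] := centered_residue a m0.
have [f [k2 [bE f1 f2]]] := centered_residue b m0.
have [g [k3 [cE g1 g2]]] := centered_residue c m0.
have [h [k4 [dE h1 h2]]] := centered_residue d m0.
subst a b c d.
set s := e ^+ 2 + f ^+ 2 + g ^+ 2 + h ^+ 2.
(* the number r with s = m r, read off from the expansion of
   m p = (e + m k1)^2 + (f + m k2)^2 + (g + m k3)^2 + (h + m k4)^2 *)
set r := p%:Z - 2 * (k1 * e + k2 * f + k3 * g + k4 * h)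
   - m * (k1 ^+ 2 + k2 ^+ 2 + k3 ^+ 2 + k4 ^+ 2).
have sE : s = m * r.
  by rewrite /r 2!mulrBr E /s; ring.
have sq_le (x : int) : - m <= 2 * x -> 2 * x <= m -> 4 * x ^+ 2 <= m ^+ 2.
  move=> lo hi; rewrite -subr_ge0.
  have -> : m ^+ 2 - 4 * x ^+ 2 = (2 * x - - m) * (m - 2 * x) by ring.
  by rewrite mulr_ge0 // subr_ge0.
have [He Hf Hg Hh] : [/\ 4 * e ^+ 2 <= m ^+ 2, 4 * f ^+ 2 <= m ^+ 2,
   4 * g ^+ 2 <= m ^+ 2 & 4 * h ^+ 2 <= m ^+ 2] by split; apply: sq_le.
have s_ge0 : 0 <= s by rewrite /s !addr_ge0 ?sqr_ge0.
have r_ge0 : 0 <= r by rewrite -(pmulr_rge0 _ m0) -sE.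
have r_le : r <= m by rewrite -(ler_pM2l m0) -sE /s; clear -He Hf Hg Hh; lia.
have [r0|r_neq0] := eqVneq r 0.
  have [x0 y0 z0 w0] : [/\ e = 0, f = 0, g = 0 & h = 0].
    have : s = 0 by rewrite sE r0 mulr0.
    rewrite /s => S0; have := (sqr_ge0 e, sqr_ge0 f, sqr_ge0 g, sqr_ge0 h).
    move=> [[[e0 f0] g0] h0]; clear -S0 e0 f0 g0 h0.
    by split; apply/eqP; rewrite -sqrf_eq0; apply/eqP; lia.
  case: (@m_ndvd (k1 ^+ 2 + k2 ^+ 2 + k3 ^+ 2 + k4 ^+ 2)).
  by move/eqP: r0; rewrite /r x0 y0 z0 w0 subr_eq0 => /eqP <-; ring.
have [rm|r_neqm] := eqVneq r m.
  (* equality forces 4 x^2 = m^2 for each of the four residues x *)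
  have half (x : int) : 4 * x ^+ 2 = m ^+ 2 -> exists t, 2 * x = t * m.
    move=> X; have : (2 * x - m) * (2 * x + m) = 0.
      by rewrite -[RHS](subrr (m ^+ 2)) -{1}X; ring.
    by move/eqP; rewrite mulf_eq0 => /orP[] /eqP X0; [exists 1|exists (- 1)];
      clear -X0; lia.
  have S : s = m ^+ 2 by rewrite sE rm.
  have [|t1 T1] := half e; first by move: S; rewrite /s; clear -He Hf Hg Hh; lia.
  have [|t2 T2] := half f; first by move: S; rewrite /s; clear -He Hf Hg Hh; lia.
  have [|t3 T3] := half g; first by move: S; rewrite /s; clear -He Hf Hg Hh; lia.
  have [|t4 T4] := half h; first by move: S; rewrite /s; clear -He Hf Hg Hh; lia.
  case: (@m_ndvd (1 + (k1 * t1 + k2 * t2 + k3 * t3 + k4 * t4)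
                   + (k1 ^+ 2 + k2 ^+ 2 + k3 ^+ 2 + k4 ^+ 2))).
  have -> : p%:Z = r + (k1 * (2 * e) + k2 * (2 * f) + k3 * (2 * g) + k4 * (2 * h))
     + m * (k1 ^+ 2 + k2 ^+ 2 + k3 ^+ 2 + k4 ^+ 2) by rewrite /r; ring.
  by rewrite T1 T2 T3 T4 rm; ring.
exists r; first by rewrite !lt_def r_neq0 r_ge0 r_le eq_sym r_neqm.
exists (r + (k1 * e + k2 * f + k3 * g + k4 * h)),
  (k1 * f - k2 * e + k3 * h - k4 * g),
  (k1 * g - k2 * h - k3 * e + k4 * f), (k1 * h + k2 * g - k3 * f - k4 * e).
apply: (mulfI (expf_neq0 2 m_neq0)).
have -> : m ^+ 2 * (r * p%:Z) = (m * r) * (m * p%:Z) by ring.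
set k := k1 * e + _ + _ + _; set y := k1 * f - _ + _ - _.
set z := k1 * g - _ - _ + _; set w := k1 * h + _ - _ - _.
have -> : m ^+ 2 * ((r + k) ^+ 2 + y ^+ 2 + z ^+ 2 + w ^+ 2)
  = (m * r + m * k) ^+ 2 + m ^+ 2 * (y ^+ 2 + z ^+ 2 + w ^+ 2) by ring.
by rewrite E -sE /s /k /y /z /w; ring.
Qed.

Lemma four_squares_prime p : prime p -> four_squares p%:Z.
Proof.
move=> p_pr; have [->|p_odd] := even_prime p_pr.
  by exists 1, 1, 0, 0.
suff D n : forall m : int, 0 < m -> m < p%:Z -> m <= n%:Z ->
    four_squares (m * p%:Z) -> four_squares p%:Z.
  have [x [y [x_lt y_lt /dvdnP[k E]]]] := minus_one_sum_two_squares p_pr p_odd.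
  have p_gt1 := prime_gt1 p_pr.
  apply: (D k k%:Z); [nia|nia|lia|].
  by exists x%:Z, y%:Z, 1, 0; nia.
elim: n => [|n IHn] m m0 mp mn S; first lia.
have [m1|m1] := eqVneq m 1; first by rewrite m1 mul1r in S.
have [|r /andP[r0 rm] R] := four_squares_descent p_pr _ mp S; first lia.
by apply: IHn R; lia.
Qed.

Theorem sum_of_four_squares (n : nat) : four_squares n%:Z.
Proof.
elim/ltn_ind: n => n IHn; have [n_le1|n_gt1] := leqP n 1.
  by case: n n_le1 {IHn} => [|[|//]] _; [exists 0, 0, 0, 0 | exists 1, 0, 0, 0].
have p_pr := pdiv_prime n_gt1; have /dvdnP[k E] := pdiv_dvd n.
have p_gt1 := prime_gt1 p_pr.
rewrite E PoszM; apply: four_squaresM; last exact: four_squares_prime.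
by apply: IHn; nia.
Qed.

(** * Lattices and their sets of values *)

Lemma finitely_generated_prod (L M : lmodType OK) :
  finitely_generated L -> finitely_generated M -> finitely_generated (L * M)%type.
Proof.
move=> [s gen_s] [t gen_t].
pose s' := [seq (x, 0 : M) | x <- s]; pose t' := [seq (0 : L, y) | y <- t].
exists (s' ++ t') => -[v w].
have [c vE] := gen_s v; have [d wE] := gen_t w.
have sz : size (s' ++ t') = (size s + size t)%N by rewrite size_cat !size_map.
pose f (i : 'I_(size s + size t)) :=
  match split i with inl j => c j | inr j => d j end.
exists (fun i => f (cast_ord sz i)).
rewrite (reindex (cast_ord (esym sz))) /=; last first.
  by exists (cast_ord sz) => i _; rewrite ?cast_ordK ?cast_ordKV.
rewrite big_split_ord /= [in LHS]vE [in LHS]wE.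
have -> : \sum_(i < size s) f (cast_ord sz (cast_ord (esym sz) (lshift (size t) i)))
    *: (s' ++ t')`_i = \sum_(i < size s) (c i *: s`_i, 0 : M).
  apply: eq_bigr => i _; rewrite cast_ordKV /f (unsplitK (inl i)) nth_cat size_map ltn_ord.
  by rewrite (nth_map 0) // -[LHS]/(_ , c i *: (0 : M)) scaler0.
have -> : \sum_(i < size t) f (cast_ord sz (cast_ord (esym sz) (rshift (size s) i)))
    *: (s' ++ t')`_(size s + i) = \sum_(i < size t) (0 : L, d i *: t`_i).
  apply: eq_bigr => i _; rewrite cast_ordKV /f (unsplitK (inr i)) nth_cat size_map.
  rewrite ltnNge leq_addr /= addKn (nth_map 0) //.
  by rewrite -[LHS]/(d i *: (0 : L), _) scaler0.
have pr1 (I : finType) (F : I -> L) : \sum_i (F i, 0 : M) = (\sum_i F i, 0).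
  apply: (big_ind2 (fun (x : L * M) y => x = (y, 0))) => // x1 x2 y1 y2 -> ->.
  by rewrite -[LHS]/(_, 0 + 0) addr0.
have pr2 (I : finType) (F : I -> M) : \sum_i (0 : L, F i) = (0, \sum_i F i).
  apply: (big_ind2 (fun (x : L * M) y => x = (0, y))) => // x1 x2 y1 y2 -> ->.
  by rewrite -[LHS]/(0 + 0, _) addr0.
by rewrite pr1 pr2 -[RHS]/(_ + 0, 0 + _) addr0 add0r.
Qed.

Lemma finitely_generated_regular : finitely_generated (OK^o : lmodType OK).
Proof.
by exists [:: 1] => x; exists (fun=> x); rewrite big_ord1 /= -[RHS]/(x * 1) mulr1.
Qed.

(** Positivity already gives torsion-freeness: if a v = 0 with a and v nonzero then
a^2 B(v, v), which is totally positive, would vanish. *)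
Lemma classical_of_bilinear (L : lmodType OK) (B : L -> L -> OK) :
  finitely_generated L ->
  (forall a u v w, B (a *: u + v) w = a * B u w + B v w) ->
  (forall v w, B v w = B w v) ->
  (forall v, v != 0 -> totally_positive (B v v)) ->
  classical_lattice (fun v => B v v).
Proof.
move=> fg linl sym pos.
have linr a u v w : B w (a *: u + v) = a * B w u + B w v.
  by rewrite sym linl [B u w]sym [B v w]sym.
have B0 w : B 0 w = 0.
  by have := linl (- 1) 0 0 w; rewrite scaler0 addr0 mulN1r addNr.
have polE v w : polar (fun v => B v v) v w = OKval (B v w).
  rewrite /polar; have := linl 1 v w (v + w); rewrite scale1r mul1r => ->.
  have := linr 1 v w v; have := linr 1 v w w; rewrite !scale1r !mul1r => -> ->.
  by rewrite [B w v]sym !(rmorphD OKval); field.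
have homog a v : B (a *: v) (a *: v) = a ^+ 2 * B v v.
  by rewrite -[a *: v]addr0 linl linr B0 [B v 0]sym B0; ring.
split=> //.
- move=> a v av0; have [a0|a_neq0] := eqVneq a 0; [by left | right].
  have [//|v_neq0] := eqVneq v 0.
  have := totally_positiveM (totally_positive_sqr a_neq0) (pos v v_neq0).
  by rewrite -homog av0 B0 => /totally_positive_neq0; rewrite eqxx.
- split=> [|a u v w|a u v w]; first exact: homog.
    by rewrite !polE linl rmorphD rmorphM.
  by rewrite !polE linr rmorphD rmorphM.
- by move=> v w; rewrite polE OKvalP.
Qed.

(** The question only depends on the set of values of a lattice, so lattices are
replaced by the sets of values that they can have. *)
Definition lattice_values (V : OK -> Prop) : Prop :=
  exists (L : lmodType OK) (Q : L -> OK),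
    classical_lattice Q /\ forall b, represents Q b <-> V b.

Lemma classical_form0 (L : lmodType OK) (Q : L -> OK) :
  classical_lattice Q -> Q 0 = 0.
Proof.
by case=> _ _ [hom _ _] _ _; have := hom 0 0; rewrite scale0r expr0n mul0r.
Qed.

Section ValueFacts.

Variable V : OK -> Prop.
Hypothesis V_lat : lattice_values V.

Lemma lattice_values0 : V 0.
Proof.
have [L [Q [cl <-]]] := V_lat; exists 0; exact: classical_form0.
Qed.

Lemma lattice_values_scale u a : V a -> V (u ^+ 2 * a).
Proof.
have [L [Q [[_ _ [hom _ _] _ _] E]]] := V_lat.
by rewrite -!E => -[v <-]; exists (u *: v).
Qed.

Lemma lattice_values_class a b : same_class a b -> V a -> V b.
Proof. by move=> [u _ ->]; exact: lattice_values_scale. Qed.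

Lemma lattice_values_tnn x : V (elt x) -> tnn x.
Proof.
have [L [Q [cl <-]]] := V_lat => -[v vE]; apply/tnnP; rewrite -vE.
have [_ _ _ _ pos] := cl.
have [->|/pos] := eqVneq v 0; last by right.
by left; exact: classical_form0.
Qed.

End ValueFacts.

Definition zero_value (b : OK) : Prop := b = 0.
Definition unary_value (e b : OK) : Prop := exists x : OK, b = e * x ^+ 2.
Definition sum_value (V W : OK -> Prop) (b : OK) : Prop :=
  exists v w : OK, [/\ V v, W w & b = v + w].

Lemma lattice_values_zero : lattice_values zero_value.
Proof.
exists 'rV[OK]_0, (fun=> 0); split.
  apply: (@classical_of_bilinear _ (fun _ _ => 0)) => //.
  - exists [::] => v; exists (fun=> 0); rewrite big_ord0; exact: thinmx0.
  - by move=> *; rewrite mulr0 addr0.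
  - by move=> v; rewrite thinmx0 eqxx.
by move=> b; split=> [[v <-]|->] //; exists 0.
Qed.

Lemma lattice_values_unary e : totally_positive e -> lattice_values (unary_value e).
Proof.
move=> e_pos; exists OK^o, (fun x : OK => e * x * x); split.
  apply: (@classical_of_bilinear OK^o (fun x y : OK => e * x * y)).
  - exact: finitely_generated_regular.
  - by move=> a u v w; rewrite -[a *: u]/(a * u : OK); ring.
  - by move=> v w; ring.
  - move=> v v_neq0; rewrite -mulrA -expr2.
    by apply: totally_positiveM => //; apply: totally_positive_sqr.
by move=> b; split=> [[x <-]|[x ->]]; exists x; ring.
Qed.

Lemma lattice_values_sum V W :
  lattice_values V -> lattice_values W -> lattice_values (sum_value V W).
Proof.
move=> [L [Q [Qcl QE]]] [M [R [Rcl RE]]].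
exists (L * M)%type, (fun v : L * M => Q v.1 + R v.2); split; last first.
  move=> b; split=> [[[v w] /= <-]|[_ [_ [/QE[v <-] /RE[w <-] ->]]]].
    by exists (Q v), (R w); split=> //; [apply/QE; exists v | apply/RE; exists w].
  by exists (v, w).
have [Q0 R0] := (classical_form0 Qcl, classical_form0 Rcl).
have [Qfg Qtf [Qhom Qll Qlr] Qint Qpos] := Qcl.
have [Rfg Rtf [Rhom Rll Rlr] Rint Rpos] := Rcl.
have polE v w : polar (fun v : L * M => Q v.1 + R v.2) v w
    = polar Q v.1 w.1 + polar R v.2 w.2.
  by rewrite /polar /=; field.
split.
- exact: finitely_generated_prod.
- move=> a [v w] E; have [a0|a_neq0] := eqVneq a 0; [by left | right].
  have /Qtf[/eqP|->] : a *: v = 0 by have := congr1 fst E.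
    by rewrite (negPf a_neq0).
  have /Rtf[/eqP|->//] : a *: w = 0 by have := congr1 snd E.
  by rewrite (negPf a_neq0).
- split=> [a [v w]|a u v w|a u v w].
  + by rewrite /= Qhom Rhom mulrDr.
  + by rewrite !polE Qll Rll; ring.
  + by rewrite !polE Qlr Rlr; ring.
- by move=> v w; rewrite polE; exact: rpredD.
- move=> [v w] vw_neq0 /=.
  have [v0|/Qpos v_pos] := eqVneq v 0.
    have [w0|/Rpos w_pos] := eqVneq w 0; first by rewrite v0 w0 eqxx in vw_neq0.
    by rewrite v0 Q0 add0r.
  have [->|/Rpos w_pos] := eqVneq w 0; first by rewrite R0 addr0.
  exact: totally_positiveD.
Qed.

(** The form with Gram matrix ((2 + phi, phi), (phi, 4 + 2 phi)), as a sum of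
squares: (2 + phi) x^2 + 2 phi x y + (4 + 2 phi) y^2, where 2 + phi = 1 + phi^2.
In this form the bounds on x and y are immediate. *)
Definition binary_form (x y : OK) : OK :=
  x ^+ 2 + (phi * x + y) ^+ 2 + elt (3, 2) * y ^+ 2.
Definition binary_value (b : OK) : Prop := exists x y : OK, b = binary_form x y.

Lemma lattice_values_binary : lattice_values binary_value.
Proof.
pose B (v w : OK^o * OK^o) : OK := (v.1 : OK) * w.1
  + (phi * v.1 + v.2) * (phi * w.1 + w.2) + elt (3, 2) * v.2 * w.2.
have BE x y : B (x, y) (x, y) = binary_form x y by rewrite /B /binary_form /=; ring.
exists (OK^o * OK^o)%type, (fun v => B v v); split; last first.
  by move=> b; split=> [[[x y] <-]|[x [y ->]]]; [exists x, y | exists (x, y)].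
apply: classical_of_bilinear.
- by apply: finitely_generated_prod; exact: finitely_generated_regular.
- move=> a [u1 u2] [v1 v2] [w1 w2]; rewrite /B /=.
  by rewrite -[a *: u1]/(a * u1 : OK) -[a *: u2]/(a * u2 : OK); ring.
- by move=> [v1 v2] [w1 w2]; rewrite /B /=; ring.
move=> [x y]; rewrite BE /binary_form => xy_neq0.
have pos32 : totally_positive (elt (3, 2)) by apply/totally_positive_elt.
have [y0|y_neq0] := eqVneq y 0.
  have x_neq0 : x != 0 by apply: contraNneq xy_neq0 => ->; rewrite y0.
  have -> : x ^+ 2 + (phi * x + y) ^+ 2 + elt (3, 2) * y ^+ 2
    = elt (2, 1) * x ^+ 2.
    by rewrite y0 addr0 exprMn [phi ^+ 2]expr2 phi_sqr /elt /=; ring.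
  apply: totally_positiveM; last exact: totally_positive_sqr.
  exact/totally_positive_elt.
have {pos32}Py := totally_positiveM pos32 (totally_positive_sqr y_neq0).
have add_sqr a b : totally_positive b -> totally_positive (a ^+ 2 + b).
  move=> Pb; have [->|/totally_positive_sqr Pa] := eqVneq a 0.
    by rewrite expr0n add0r.
  exact: totally_positiveD.
by rewrite -addrA; do 2!apply: (add_sqr).
Qed.

(** * Values below a bound *)

Definition values_below (V : OK -> Prop) (al : int * int) (S : seq (int * int)) :=
  forall x, x \in S <-> V (elt x) /\ tnn (al - x).

(** The bound 16 on traces in the lemmas below covers all seven classes, the
largest trace being that of 3 (2 + phi), which is 15.  This box contains every
(p, q) with p^2 + (p + q)^2 + 2 q^2 < 16. *)
Definition box : seq (int * int) :=
  [seq (p, q) | p <- [:: -3; -2; -1; 0; 1; 2; 3], q <- [:: -2; -1; 0; 1; 2]].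

Definition unary_list (e al : int * int) : seq (int * int) :=
  undup [seq y <- [seq pmul e (pmul x x) | x <- box] | tnn (al - y)].

Definition sum_list al (S T : seq (int * int)) : seq (int * int) :=
  undup [seq y <- [seq x + y | x <- S, y <- T] | tnn (al - y)].

Definition binary_pair (x y : int * int) : int * int :=
  let z := pmul (0, 1) x + y in
  pmul x x + pmul z z + pmul (3, 2) (pmul y y).

Definition binary_list al : seq (int * int) :=
  undup [seq y <- [seq binary_pair x y | x <- box, y <- box] | tnn (al - y)].

(** The condition that 1 lies below e bounds all x with e x^2 below a given
element by the trace of x^2 alone.  Every class has such a representative. *)
Definition ge1 (e : int * int) : bool := tnn (e - (1, 0)).

Lemma elt0 : elt 0 = 0. Proof. by rewrite /elt mul0r addr0. Qed.

Lemma tnn_trace x : tnn x -> 0 <= trace x.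
Proof. by case/orP=> [/eqP->|/tpP[/ltW]]. Qed.

Lemma traceD x y : trace (x + y) = trace x + trace y.
Proof. by rewrite /trace /=; ring. Qed.

Lemma traceB x y : trace (x - y) = trace x - trace y.
Proof. by rewrite /trace /=; ring. Qed.

(** The trace of e x^2 is at least that of x^2, which is the positive definite
form p^2 + (p + q)^2 + 2 q^2. *)
Lemma square_in_box e al x : trace al < 16 -> ge1 e ->
  tnn (al - pmul e (pmul x x)) -> x \in box.
Proof.
move=> al16 e1 le_al.
have E : pmul e (pmul x x) = pmul (e - (1, 0)) (pmul x x) + pmul x x.
  by case: e x {e1 le_al} => e1 e2 [p q]; rewrite /pmul; congr pair => /=; ring.
have := tnn_trace (tnnM e1 (tnn_sqr x)).
have := tnn_trace le_al; rewrite E traceB traceD.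
move: (trace (pmul _ (pmul x x))) => t le1 t0 {E e1 le_al}.
have {t t0 le1} : trace (pmul x x) < 16 by clear -al16 t0 le1; lia.
case: x => p q; rewrite /trace /pmul /=.
have -> : 2 * (p * p + q * q) + (p * q + q * p + q * q)
  = p ^+ 2 + (p + q) ^+ 2 + 2 * q ^+ 2 by ring.
move: (sqr_ge0 p) (sqr_ge0 (p + q)) (sqr_ge0 q); clear => p0 s0 q0 lt16.
have p3 : -3 <= p <= 3.
  have : p ^+ 2 < 16 by lia.
  by clear; nia.
have {p0 s0 q0 lt16}q2 : -2 <= q <= 2.
  have : q ^+ 2 < 9 by lia.
  by clear; nia.
have : p = -3 \/ p = -2 \/ p = -1 \/ p = 0 \/ p = 1 \/ p = 2 \/ p = 3 by lia.
have : q = -2 \/ q = -1 \/ q = 0 \/ q = 1 \/ q = 2 by lia.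
by do ?[case]=> ->; do ?[case]=> ->.
Qed.

Lemma zero_below al : tnn al -> values_below zero_value al [:: 0].
Proof.
move=> al0 x; rewrite inE; split=> [/eqP->|[+ _]].
  by split; [exact: elt0 | rewrite subr0].
by rewrite /zero_value -elt0 => /elt_inj->.
Qed.

Lemma unary_below e al : trace al < 16 -> ge1 e ->
  values_below (unary_value (elt e)) al (unary_list e al).
Proof.
move=> al16 e1 y; rewrite mem_undup mem_filter; split=> [/andP[-> /mapP[x _ ->]]|].
  by split=> //; exists (elt x); rewrite expr2 -!eltM.
move=> [[a]]; have [x ->] := elt_surj a.
rewrite expr2 -!eltM => /elt_inj-> le_al; rewrite le_al andTb.
by apply/mapP; exists x; first exact: (square_in_box al16 e1 le_al).
Qed.

Lemma binary_pairE x y : elt (binary_pair x y) = binary_form (elt x) (elt y).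
Proof.
have phiE : elt (0, 1) = phi by rewrite /elt mul1r add0r.
by rewrite /binary_pair /binary_form !(eltD, eltM) phiE; ring.
Qed.

Lemma binary_below al : trace al < 16 ->
  values_below binary_value al (binary_list al).
Proof.
move=> al16 z; rewrite mem_undup mem_filter; split.
  move=> /andP[-> /allpairsP[[x y] [_ _ ->]]]; split=> //.
  by exists (elt x), (elt y); rewrite binary_pairE.
move=> [[a [b]]]; have [x ->] := elt_surj a; have [y ->] := elt_surj b.
rewrite -binary_pairE => /elt_inj-> le_al; rewrite le_al andTb.
set s := pmul (pmul (0, 1) x + y) (pmul (0, 1) x + y).
have one (t : int * int) : pmul (1, 0) t = t.
  by case: t => p q; rewrite /pmul /=; congr pair; ring.
apply: (allpairs_f binary_pair).
  apply: (@square_in_box (1, 0) al x al16) => //.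
  have -> : al - pmul (1, 0) (pmul x x)
    = (al - binary_pair x y) + (s + pmul (3, 2) (pmul y y)).
    by rewrite one /binary_pair -/s; ring.
  by apply: tnnD le_al (tnnD (tnn_sqr _) (tnnM _ (tnn_sqr _))).
apply: (@square_in_box (3, 2) al y al16) => //.
have -> : al - pmul (3, 2) (pmul y y)
  = (al - binary_pair x y) + (pmul x x + s).
  by rewrite /binary_pair -/s; ring.
exact: tnnD le_al (tnnD (tnn_sqr _) (tnn_sqr _)).
Qed.

(** If x + y is below al, then so are x and y, since values of lattices are
totally nonnegative; this is why the lists may be truncated at al at each step
without losing a decomposition of al. *)
Lemma sum_below V W al S T :
  lattice_values V -> lattice_values W ->
  values_below V al S -> values_below W al T ->
  values_below (sum_value V W) al (sum_list al S T).
Proof.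
move=> Vl Wl VS WT z; rewrite mem_undup mem_filter; split.
  move=> /andP[-> /allpairsP[[x y] /= [/VS[Vx _] /WT[Wy _] ->]]]; split=> //.
  by exists (elt x), (elt y); rewrite eltD.
move=> [[a [b []]]]; have [x ->] := elt_surj a; have [y ->] := elt_surj b.
rewrite -eltD => Vx Wy /elt_inj-> le_al; rewrite le_al andTb.
apply: allpairs_f; [apply/VS|apply/WT]; split=> //.
  have -> : al - x = (al - (x + y)) + y by ring.
  exact/tnnD/(lattice_values_tnn Wl).
have -> : al - y = (al - (x + y)) + x by ring.
exact/tnnD/(lattice_values_tnn Vl).
Qed.

Definition diag_value (es : seq (int * int)) (V : OK -> Prop) : OK -> Prop :=
  foldr (fun e => sum_value (unary_value (elt e))) V es.

Definition diag_list al (es S : seq (int * int)) : seq (int * int) :=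
  foldr (fun e => sum_list al (unary_list e al)) S es.

Lemma ge1_tp e : ge1 e -> totally_positive (elt e).
Proof.
have pos1 : totally_positive (elt (1, 0)) by apply/totally_positive_elt.
rewrite /ge1 => /orP[/eqP/subr0_eq->//|/totally_positive_elt H].
by rewrite -[e](subrK (1, 0)) eltD; apply: totally_positiveD.
Qed.

Lemma ge1_nat (n : nat) : (0 < n)%N -> ge1 (n%:Z, 0).
Proof.
case: n => // n _; have -> : (n.+1%:Z, 0) = (1, 0) + (n%:Z, 0) :> (int * int)%type.
  by congr pair => /=; lia.
rewrite /ge1 addrAC subrr add0r /tnn /tp /trace /norm.
by case: n => //= n; apply/orP; right; apply/andP; split; lia.
Qed.

Lemma diag_lattice es V : all ge1 es ->
  lattice_values V -> lattice_values (diag_value es V).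
Proof.
elim: es => //= e es IH /andP[e1 es1] Vl; apply: lattice_values_sum; last exact: IH.
exact/lattice_values_unary/ge1_tp.
Qed.

Lemma diag_below es V al S : trace al < 16 ->
  all ge1 es ->
  lattice_values V -> values_below V al S ->
  values_below (diag_value es V) al (diag_list al es S).
Proof.
move=> al16; elim: es => //= e es IH /andP[e1 es1] Vl VS.
apply: sum_below; [|exact: diag_lattice|exact: unary_below|exact: IH].
exact/lattice_values_unary/ge1_tp.
Qed.

Lemma diag_mem es V e : lattice_values V -> all ge1 es ->
  e \in es -> diag_value es V (elt e).
Proof.
move=> Vl; elim: es => //= f es IH /andP[f1 es1]; rewrite inE => /orP[/eqP->|/IH].
  exists (elt f), 0; split; [|exact: lattice_values0 (diag_lattice es1 Vl)|by rewrite addr0].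
  by exists 1; rewrite expr1n mulr1.
move=> /(_ es1) V_e; exists 0, (elt e); split=> //; last by rewrite add0r.
by exists 0; rewrite expr0n mulr0.
Qed.

Lemma diag_nseq d V v (xs : seq OK) : V v ->
  diag_value (nseq (size xs) d) V (v + elt d * \sum_(x <- xs) x ^+ 2).
Proof.
move=> Vv; elim: xs => [|x xs IH] /=; first by rewrite big_nil mulr0 addr0.
exists (elt d * x ^+ 2), (v + elt d * \sum_(y <- xs) y ^+ 2).
by split=> //; [exists x | rewrite big_cons; ring].
Qed.

(** Four squares for a, and four for b multiplied by beta = phi^2. *)
Lemma cone_sum_squares a b :
  exists2 xs : seq OK, size xs = 8%N & elt (cone a b) = \sum_(x <- xs) x ^+ 2.
Proof.
have [a1 [a2 [a3 [a4 aE]]]] := sum_of_four_squares a.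
have [b1 [b2 [b3 [b4 bE]]]] := sum_of_four_squares b.
exists [:: a1%:~R; a2%:~R; a3%:~R; a4%:~R; phi * b1%:~R; phi * b2%:~R;
  phi * b3%:~R; phi * b4%:~R] => //.
have -> : elt (cone a b) = (Posz a)%:~R + phi ^+ 2 * (Posz b)%:~R.
  by rewrite expr2 phi_sqr /elt /= rmorphD /=; ring.
rewrite aE bE !big_cons big_nil !rmorphD !rmorphXn /=; ring.
Qed.

(** * Covering all classes by finitely many values *)

(** The pairs (a, b) in the class of al.  The bound 4 holds for all pairs in the
classes of interest; with it in the definition, the subtraction of d from a
coordinate that is at least 4 + d never ends in an exceptional pair. *)
Definition exceptional al (a b : nat) : bool :=
  [&& (a < 4)%N, (b < 4)%N & (cone a b == al) || (cone a b == pmul beta al)].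

Definition covered (d : nat) (x f : int * int) : bool :=
  let y := x - f in
  [&& 0 <= y.1 - y.2, 0 <= y.2, (d %| y.1 - y.2)%Z & (d %| y.2)%Z].

(** A lattice that represents f represents beta f too, so both are tried. *)
Definition coverb al d cand (a b : nat) : bool :=
  exceptional al a b ||
  has (fun f => covered d (cone a b) f || covered d (cone a b) (pmul beta f)) cand.

Definition cover_check al d cand : bool :=
  all (fun a => all (coverb al d cand a) (iota 0 (4 + d))) (iota 0 (4 + d)).

Lemma coneD a b a' b' : cone (a + a') (b + b') = cone a b + cone a' b'.
Proof. by rewrite /cone; congr pair; rewrite /= !PoszD; ring. Qed.

Lemma coveredP d x f : (0 < d)%N -> covered d x f ->
  exists k l : nat, x = f + cone (d * k) (d * l).
Proof.
move=> d0; rewrite /covered; set y := x - f => /and4P[y0 y1 /dvdzP[k kE] /dvdzP[l lE]].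
have dpos : 0 < d%:Z by [].
have k0 : 0 <= k by move: y0; rewrite kE pmulr_lge0.
have l0 : 0 <= l by move: y1; rewrite lE pmulr_lge0.
exists `|k|%N, `|l|%N; have -> : x = f + y by rewrite /y addrC subrK.
congr (f + _); rewrite /cone !PoszM !gez0_abs //.
by case: y kE lE {y0 y1} => p q /= kE lE; congr pair; lia.
Qed.

(** A pair with a coordinate at least 4 + d reduces to a smaller one by
subtracting d from that coordinate, so a finite box decides. *)
Lemma coverP al d cand : (0 < d)%N -> cover_check al d cand ->
  forall a b, exceptional al a b \/
    exists f k l, f \in cand /\
      (cone a b = f + cone (d * k) (d * l) \/
       cone a b = pmul beta f + cone (d * k) (d * l)).
Proof.
move=> d0 chk a b.
have [n] := ubnP (a + b)%N; elim: n a b => // n IHn a b lt_n.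
have step a' b' k0 l0 : (a' + b' < n)%N -> cone a b = cone a' b' + cone (d * k0) (d * l0) ->
    exceptional al a' b' = false -> exists f k l, f \in cand /\
      (cone a b = f + cone (d * k) (d * l) \/
       cone a b = pmul beta f + cone (d * k) (d * l)).
  move=> lt' -> exc; have [|[f [k [l [fc E]]]]] := IHn a' b' lt'; first by rewrite exc.
  exists f, (k + k0)%N, (l + l0)%N; split=> //; rewrite !mulnDr coneD !addrA.
  by case: E => ->; [left|right].
have [a_lt|a_ge] := ltnP a (4 + d); last first.
  right; apply: (step (a - d)%N b 1%N 0%N); first lia.
    by rewrite muln1 muln0 -coneD addn0 subnK //; lia.
  by rewrite /exceptional ltnNge (_ : (4 <= a - d)%N = true) //; lia.
have [b_lt|b_ge] := ltnP b (4 + d); last first.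
  right; apply: (step a (b - d)%N 0%N 1%N); first lia.
    by rewrite muln1 muln0 -coneD addn0 subnK //; lia.
  by rewrite /exceptional [(b - d < 4)%N]ltnNge (_ : (4 <= b - d)%N = true) ?andbF //; lia.
have a_in : a \in iota 0 (4 + d) by rewrite mem_iota.
have b_in : b \in iota 0 (4 + d) by rewrite mem_iota.
have /orP[|/hasP[f fc]] := allP (allP chk a a_in) b b_in; first by left.
by case/orP=> /(coveredP d0)[k [l E]]; right; exists f, k, l; split=> //; [left|right].
Qed.

(** * Lattices that miss exactly one class *)

Section MissingClass.

Variables (V0 : OK -> Prop) (S0 : seq (int * int)).
Variables (al : int * int) (d : nat) (es : seq (int * int)).

Hypothesis V0_lat : lattice_values V0.
Hypothesis V0_below : values_below V0 al S0.
Hypothesis al_small : trace al < 16.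
Hypothesis d_gt0 : (0 < d)%N.
Hypothesis es_ge1 : all ge1 es.

Let dd : seq (int * int) := nseq 8 (d%:Z, 0).

Hypothesis missing : al \notin diag_list al dd (diag_list al es S0).
Hypothesis cover : cover_check al d (diag_list al es S0 ++ es).

(** The lattice is V0 + <es> + d I_8.  The values that cover all pairs are es and the
values of V0 + <es> below al: the list that shows that al is not represented
also certifies that these elements are represented. *)
Lemma missing_class : exists (L : lmodType OK) (Q : L -> OK),
  classical_lattice Q /\ represents_all_but Q (elt al).
Proof.
pose V := diag_value es V0; pose W := diag_value dd V.
have V_lat : lattice_values V by apply: diag_lattice.
have dd_ge1 : all ge1 dd by apply/allP=> e /nseqP[-> _]; exact: ge1_nat.
have W_lat : lattice_values W by apply: diag_lattice.
have W_al : ~ W (elt al).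
  have below := diag_below al_small dd_ge1 V_lat
    (diag_below al_small es_ge1 V0_lat V0_below).
  by move=> Wal; move/negP: missing; apply; apply/below; rewrite subrr.
have W_cone a b : ~ same_class (elt al) (elt (cone a b)) -> W (elt (cone a b)).
  move=> ncl; have [|[f [k [l [fc E]]]]] := coverP d_gt0 cover a b.
    case/and3P=> _ _ /orP[]/eqP ab; case: ncl; rewrite ab.
      exact: same_class_refl.
    exact: same_class_beta.
  have Vf : V (elt f).
    move: fc; rewrite mem_cat => /orP[|f_es].
      by move/(diag_below al_small es_ge1 V0_lat V0_below) => [].
    exact: diag_mem.
  have Vbf : V (elt (pmul beta f)).
    by rewrite eltM elt_beta; exact: lattice_values_scale.
  have [xs xs8 xsE] := cone_sum_squares k l.
  have sumW v : V v -> W (v + elt (cone (d * k) (d * l))).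
    move=> Vv; have -> : elt (cone (d * k) (d * l)) = elt (d%:Z, 0) * elt (cone k l).
      by rewrite -eltM /pmul /cone /= !PoszM; congr elt; congr pair; ring.
    by rewrite xsE /W /dd -xs8; exact: diag_nseq.
  by case: E => ->; rewrite eltD; exact: sumW.
have [L [Q [cl QW]]] := W_lat; exists L, Q; split=> // b b_pos.
rewrite QW; split=> [Wb ab|nab].
  exact/W_al/(lattice_values_class W_lat _ Wb)/same_class_sym.
have [x bE] := elt_surj b; move: b_pos nab; rewrite bE => /totally_positive_elt xpos nab.
have [a [c acx]] := cone_class xpos.
apply: (lattice_values_class W_lat acx); apply: W_cone => ac; apply: nab.
exact: same_class_trans ac acx.
Qed.

End MissingClass.

Lemma missing_class_diag al d es : tnn al -> trace al < 16 -> (0 < d)%N ->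
  all ge1 es ->
  al \notin diag_list al (nseq 8 (d%:Z, 0)) (diag_list al es [:: 0]) ->
  cover_check al d (diag_list al es [:: 0] ++ es) ->
  exists (L : lmodType OK) (Q : L -> OK),
    classical_lattice Q /\ represents_all_but Q (elt al).
Proof.
move=> al0; apply: missing_class; first exact: lattice_values_zero.
exact: zero_below.
Qed.

(** In the lists below the elements that are not among those named at the top of
the file have no nonzero multiple e x^2 below al and only complete the residues
modulo d. *)
Definition cones (s : seq (nat * nat)) := [seq cone x.1 x.2 | x <- s].

Lemma missing_1 : exists (L : lmodType OK) (Q : L -> OK),
  classical_lattice Q /\ represents_all_but Q (elt (1, 0)).
Proof.
by apply: (@missing_class_diag _ 2 (cones [:: (1, 1); (1, 2); (2, 1); (3, 0)]));
  vm_compute.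
Qed.

Lemma missing_2 : exists (L : lmodType OK) (Q : L -> OK),
  classical_lattice Q /\ represents_all_but Q (elt (2, 0)).
Proof.
by apply: (@missing_class_diag _ 3 (cones
  [:: (1, 0); (1, 1); (1, 2); (2, 1); (2, 2); (2, 3); (3, 2); (5, 0)]));
  vm_compute.
Qed.

Lemma missing_sqrt5 : exists (L : lmodType OK) (Q : L -> OK),
  classical_lattice Q /\ represents_all_but Q (elt (2, 1)).
Proof.
by apply: (@missing_class_diag _ 2 (cones [:: (1, 0); (3, 1)])); vm_compute.
Qed.

Lemma missing_norm11 : exists (L : lmodType OK) (Q : L -> OK),
  classical_lattice Q /\ represents_all_but Q (elt (3, 1)).
Proof.
by apply: (@missing_class_diag _ 3
  (cones [:: (1, 0); (1, 0); (1, 2); (2, 2); (5, 1)])); vm_compute.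
Qed.

(** The representative 4 - phi is used, rather than the element 1 + 2 beta of its
class, because 2 lies below the former and not below the latter: the list of
values below 4 - phi then certifies that 2 = 1 + 1 is represented. *)
Lemma missing_norm11' : exists (L : lmodType OK) (Q : L -> OK),
  classical_lattice Q /\ represents_all_but Q (elt (4, -1)).
Proof.
by apply: (@missing_class_diag _ 3
  (cones [:: (1, 0); (1, 0); (2, 1); (2, 2); (1, 5)])); vm_compute.
Qed.

Lemma missing_2sqrt5 : exists (L : lmodType OK) (Q : L -> OK),
  classical_lattice Q /\ represents_all_but Q (elt (4, 2)).
Proof.
by apply: (@missing_class_diag _ 3
  (cones [:: (1, 0); (2, 0); (1, 1); (5, 2)])); vm_compute.
Qed.

Lemma missing_3sqrt5 : exists (L : lmodType OK) (Q : L -> OK),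
  classical_lattice Q /\ represents_all_but Q (elt (6, 3)).
Proof.
apply: (@missing_class binary_value (binary_list (6, 3)) _ 5 (cones
  [:: (1, 0); (2, 0); (1, 4); (4, 1); (2, 4); (4, 2); (8, 3)])).
- exact: lattice_values_binary.
- exact: binary_below.
- by vm_compute.
- by [].
- by vm_compute.
- by vm_compute.
- by vm_compute.
Qed.

(** * Minimality *)

Definition lee_coords : seq (int * int) :=
  [:: (1, 0); (2, 0); (2, 1); (3, 1); (4, -1); (4, 2); (6, 3)].

Lemma lee_elt c : OKval c \in lee_list -> exists2 x : int * int, c = elt x & x \in lee_coords.
Proof.
have E x : c = elt x <-> OKval c = x.1%:~R + x.2%:~R * golden.
  have vE : OKval (elt x) = x.1%:~R + x.2%:~R * golden.
    by rewrite (rmorphD OKval) (rmorphM OKval) !(rmorph_int OKval).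
  by rewrite -vE; split=> [->|/val_inj].
have num (x : int * int) : OKval c = x.1%:~R + x.2%:~R * golden ->
    x \in lee_coords -> exists2 x, c = elt x & x \in lee_coords.
  by move=> /E cx ?; exists x.
rewrite !inE => /or4P[|||/or4P[]] /eqP cE;
  [apply: (num (1, 0))|apply: (num (2, 0))|apply: (num (2, 1))
  |apply: (num (3, 1))|apply: (num (4, -1))|apply: (num (4, 2))
  |apply: (num (6, 3))]; by [|rewrite cE /golden /=; field].
Qed.

Lemma represents_all_but_class (L : lmodType OK) (Q : L -> OK) a b :
  same_class a b -> represents_all_but Q a -> represents_all_but Q b.
Proof.
move=> ab Qa c c_pos; rewrite Qa //; split=> nc cc; apply: nc.
  exact: same_class_trans ab cc.
exact: same_class_trans (same_class_sym ab) cc.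
Qed.

Lemma not_universal (L : lmodType OK) (Q : L -> OK) a :
  totally_positive a -> represents_all_but Q a -> ~ universal Q.
Proof. by move=> a_pos Qa U; case: ((Qa a a_pos).1 (U a a_pos)); exact: same_class_refl. Qed.

(** Otherwise the lattice represents all of S, since S is saturated for
[same_class], and would be universal. *)
Lemma criterion_meets_missed (S : OK -> Prop) (L : lmodType OK) (Q : L -> OK) a :
  criterion_set S -> classical_lattice Q -> totally_positive a ->
  represents_all_but Q a -> S a.
Proof.
move=> [[S_pos S_class] crit] cl a_pos Qa; apply: NNPP => nSa.
apply: (not_universal a_pos Qa); apply/(crit L Q cl) => b Sb.
apply/(Qa b (S_pos b Sb)) => /same_class_sym ba; apply: nSa.
exact: S_class ba Sb.
Qed.

Theorem theorem7p1 :
  (forall alpha : OK, lee_set alpha ->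
     exists (L : lmodType OK) (Q : L -> OK),
       classical_lattice Q /\ represents_all_but Q alpha)
  /\
  (criterion_set lee_set ->
     minimal_criterion_set lee_set
     /\ (forall alpha : OK, lee_set alpha <-> Ccl alpha)).
Proof.
have missed alpha : lee_set alpha -> exists (L : lmodType OK) (Q : L -> OK),
    classical_lattice Q /\ represents_all_but Q alpha.
  move=> [c /lee_elt[x -> x_lee] calpha].
  suff [L [Q [cl Qx]]] : exists (L : lmodType OK) (Q : L -> OK),
      classical_lattice Q /\ represents_all_but Q (elt x).
    by exists L, Q; split=> //; exact: represents_all_but_class Qx.
  move: x_lee {calpha}; rewrite !inE.
  case/or4P => [/eqP->|/eqP->|/eqP->|/or4P[] /eqP->].
  - exact: missing_1.
  - exact: missing_2.
  - exact: missing_sqrt5.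
  - exact: missing_norm11.
  - exact: missing_norm11'.
  - exact: missing_2sqrt5.
  - exact: missing_3sqrt5.
split=> // crit; have lee_pos := crit.1.1.
split.
  split=> // S crit' sub a lee_a; have [L [Q [cl Qa]]] := missed a lee_a.
  by apply: (criterion_meets_missed crit' cl _ Qa); exact: lee_pos.
move=> a; split=> [lee_a|[a_pos [L [Q [cl Qa]]]]].
  by split; [exact: lee_pos | exact: missed].
exact: criterion_meets_missed crit cl a_pos Qa.
Qed.
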